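(* Consider the system $$\dot\phi_i=\bar\omega_i+\frac{K}{n}\sum_{j\in N_i}\sin(\phi_j-\phi_i),\qquad i=1,\dots,n,$$ in which the underlying topology is a graph $G$ with diameter $\le 2$, where the constants $\bar\omega_i$ satisfy $\sum_{i=1}^n\bar\omega_i=0$, and let $\vec\phi^{\,t}\in\mathbb{R}^n$, $t\ge 0$, be its trajectory from a given initial condition $\vec\phi^{\,0}$. Let $D_t=\max_i\phi_i^t-\min_i\phi_i^t$. If $D$ is a constant satisfying $0<D_0\le D<\pi$, and $$K\ge\frac{n\,|\bar\omega_i-\bar\omega_j|}{P_{ij}\,\sin D}\qquad\text{for all } i,j=1,\dots,n,$$ then $D_t\le D$ for all $t\ge 0$, and the system achieves frequency synchronization.
   Context: $G=(V,E)$ is a finite undirected graph with vertex set $V=\{1,\dots,n\}$ (the oscillators) and edge set $E$; its diameter is the maximum over pairs of vertices of the number of edges in a shortest path between them. $N_i$ is the set of neighbors of $i$ in $G$. Phases are real-valued (trajectories are considered in $\mathbb{R}^n$). The constants $\bar\omega_i=\omega_i-\frac1n\sum_{k=1}^n\omega_k$ are the deviations of constant, not necessarily equal, intrinsic frequencies $\omega_i\in\mathbb{R}$ from their average, so $\sum_i\bar\omega_i=0$. $K$ is the coupling strength, the same for all edges. Let $A$ be the symmetric $0/1$ adjacency matrix of $G$, with $i$-th row $\mathbf{a_i}$; then $P_{ij}=\mathbf{a_i}\cdot\mathbf{a_j}^T+2A_{ij}$, i.e. $P_{ij}$ is the number of common neighbors of $i$ and $j$, plus $2$ if $i$ and $j$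 are joined by an edge. The system achieves frequency synchronization if all $\dot\phi_i(t)$ become equal as $t\to\infty$; since here $\sum_i\dot\phi_i=0$, this means $\dot\phi_i(t)\to 0$ as $t\to\infty$ for every $i=1,\dots,n$. *)

(* Defs.v *)
From HB Require Import structures.
From mathcomp Require Import all_boot all_order all_algebra.
From mathcomp Require Import all_classical all_reals all_analysis.

Set Implicit Arguments.
Unset Strict Implicit.
Unset Printing Implicit Defensive.

Import Order.TTheory GRing.Theory Num.Theory.
Import numFieldNormedType.Exports.

Local Open Scope classical_set_scope.
Local Open Scope ring_scope.

Record sgraph (n : nat) := SGraph {
  adj :> rel 'I_n ;
  adj_sym : symmetric adj ;
  adj_irrefl : irreflexive adj }.

Definition is_gpath (n : nat) (G : sgraph n) (i j : 'I_n) (p : seq 'I_n) : bool :=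
  [&& path G i p, last i p == j & uniq (i :: p)].

(* [size p] is the number of edges of the path [i :: p]. The distance is
   [+oo] between vertices in different components (infimum of the empty set),
   so a finite bound on the diameter entails connectedness. *)
Definition gdist (R : realType) (n : nat) (G : sgraph n) (i j : 'I_n) : \bar R :=
  ereal_inf [set ((size p)%:R)%:E | p in [set p | is_gpath G i j p]].

Definition diameter (R : realType) (n : nat) (G : sgraph n) : \bar R :=
  ereal_sup [set gdist R G ij.1 ij.2 | ij in [set: 'I_n * 'I_n]].

Definition adjmx (R : realType) (n : nat) (G : sgraph n) : 'M[R]_n :=
  \matrix_(i, j) (G i j)%:R.

Definition Pmx (R : realType) (n : nat) (G : sgraph n) : 'M[R]_n :=
  let A := adjmx R G in
  \matrix_(i, j) ((row i A *m (row j A)^T) 0 0 + 2 * A i j).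

Definition kuramoto_field (R : realType) (n : nat) (G : sgraph n)
    (wbar : 'I_n -> R) (K : R) (x : 'I_n -> R) (i : 'I_n) : R :=
  wbar i + K / n%:R * \sum_(j | G i j) sin (x j - x i).

(* Solution on the closed half-line t >= 0; values at t < 0 are irrelevant.
   Continuity at 0 from the right together with the equation on t > 0 yields
   the equation at 0 for the right derivative. *)
Definition kuramoto_trajectory (R : realType) (n : nat) (G : sgraph n)
    (wbar : 'I_n -> R) (K : R) (phi : R -> 'I_n -> R) : Prop :=
  forall i : 'I_n,
    {within `[0, +oo[, continuous (phi^~ i)} /\
    (forall t : R, 0 < t ->
       is_derive t 1 (phi^~ i) (kuramoto_field G wbar K (phi t) i)).

(* The seed [x ord0] is one of the values, so these are the true maximum and
   minimum over the (nonempty) vertex set. *)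
Definition phase_spread (R : realType) (n : nat) (x : 'I_n.+1 -> R) : R :=
  \big[Num.max/x ord0]_i x i - \big[Num.min/x ord0]_i x i.

(* As the frequencies sum to zero along trajectories, their only possible
   common limiting value is 0. *)
Definition frequency_sync (R : realType) (n : nat) (phi : R -> 'I_n -> R) : Prop :=
  forall i : 'I_n, derive1 (phi^~ i) t @[t --> +oo] --> (0 : R).

(* Main.v *)
Require Import Defs.
From HB Require Import structures.
From mathcomp Require Import all_boot all_order all_algebra.
From mathcomp Require Import all_classical all_reals all_analysis.
From mathcomp Require Import ring lra.

Set Implicit Arguments.
Unset Strict Implicit.
Unset Printing Implicit Defensive.

Import Order.TTheory GRing.Theory Num.Theory.
Import numFieldNormedType.Exports.

Local Open Scope classical_set_scope.
Local Open Scope ring_scope.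

(** Invariance of the bound on the spread. Let [i] and [j] carry the largest
    and the smallest phase, at distance [S = x i - x j <= pi]. Every neighbor
    of [i] pulls it down and every neighbor of [j] pulls it up; a common
    neighbor [k] contributes [sin (x i - x k) + sin (x k - x j) >= sin S],
    because the sine is subadditive on arcs of total length at most [pi], and
    an edge between [i] and [j] contributes [2 * sin S]. So the gap grows at a
    rate at most [w i - w j - K / n * P i j * sin S]
    ([field_extremal_gap_le]). Diameter at most 2 makes every off-diagonal
    [P i j] positive ([Pmx_gt0]), so the lower bound on [K] makes this rate
    nonpositive at [S = D]. A nonpositive rate at the boundary does not by
    itself prevent crossing; but the sine is 1-Lipschitz, so beyond [D] the
    rate is at most a constant times the excess [S - D], and the excess cannot
    catch up with a barrier [d * exp (c * s)] when [c] is strictly larger than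
    that constant ([gap_invariant], through [first_crossing]).

    Synchronization. The system is the gradient flow of
    [- \sum_i w i * x i - (K / n) * \sum_(edges) cos (x j - x i)], so this
    potential decreases at the rate [\sum_i (phi_i')^2]
    ([potential_is_derive]). Since the frequencies sum to zero, the potential
    only depends on phase differences and is bounded below as long as the
    spread is bounded ([potential_bounded_below]). The rate of decrease is
    Lipschitz in time, so Barbalat's argument ([dissipation_cvg0]) makes it
    tend to zero, and every [phi_i'] with it. *)

(** * Sums and bounds in one real variable *)

Lemma lipschitz_of_derive_bound (R : realType) (i : interval R) (f df : R -> R)
    (B : R) :
  {in i, forall t : R, is_derive t 1 f (df t)} ->
  {in i, forall t, `|df t| <= B} ->
  {in i &, forall s t : R, `|f s - f t| <= B * `|s - t|}.
Proof.
move=> fD dfB.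
suff le_case s t : s \in i -> t \in i -> s <= t -> `|f s - f t| <= B * `|s - t|.
  move=> s t si ti; have [st|/ltW ts] := leP s t; first exact: le_case.
  by rewrite distrC (distrC s); exact: le_case.
move=> si ti st.
have sub u : u \in `[s, t] -> u \in i.
  move=> /itvP stu.
  by apply: (@interval_is_interval _ i s t) => //; rewrite !stu.
have [||c cst fE] := @MVT_segment R f df s t st.
- by move=> u ust; apply: fD; apply: sub; exact: subset_itv_oo_cc.
- apply: derivable_within_continuous => v /sub vi.
  by have := fD v vi.
rewrite distrC fE normrM (distrC s) ler_wpM2r//; exact/dfB/sub.
Qed.

Lemma sin_lipschitz (R : realType) (x y : R) : `|sin x - sin y| <= `|x - y|.
Proof.
rewrite -[leRHS]mul1r.
apply: (@lipschitz_of_derive_bound R `]-oo, +oo[ sin cos 1); rewrite ?in_itv//.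
- by move=> t _; exact: is_derive_sin.
- by move=> t _; exact: cos_max.
Qed.

Lemma sinD_le (R : realType) (a b : R) : 0 <= a <= pi -> 0 <= b <= pi ->
  sin (a + b) <= sin a + sin b.
Proof.
move=> /sin_ge0_pi sa /sin_ge0_pi sb; rewrite sinD lerD//.
  by rewrite ler_piMr// cos_le1.
by rewrite mulrC ler_piMr// cos_le1.
Qed.

Lemma is_derive_bigsum (R : realType) (I : Type) (r : seq I) (P : pred I)
    (f : I -> R -> R) (df : I -> R) (t : R) :
  (forall i, P i -> is_derive t 1 (f i) (df i)) ->
  is_derive t 1 (fun u => \sum_(i <- r | P i) f i u) (\sum_(i <- r | P i) df i).
Proof.
move=> fD; elim: r => [|a r IH].
  by rewrite big_nil; under eq_fun do rewrite big_nil; exact: is_derive_cst.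
rewrite big_cons; under eq_fun do rewrite big_cons.
case: ifP => // Pa; have fDa := fD a Pa.
exact: (@is_deriveD _ _ _ (f a)).
Qed.

(** * A barrier principle for finite families of functions *)

Lemma left_max_derive_ge0 (R : realType) (f : R -> R) (t df : R) :
  is_derive t 1 f df -> (\forall x \near t^'-, f x <= f t) -> 0 <= df.
Proof.
move=> [fD dfE] fle; rewrite leNgt; apply/negP => df_lt0.
have : h^-1 *: ((f \o shift t) (h *: 1) - f t) @[h --> 0^'] --> df.
  by rewrite -dfE; exact: fD.
move=> /cvgr_lt/(_ _ df_lt0)[d /= d0 quot_lt0].
case: fle => e /= e0 fle.
pose h := Num.min d e / 2.
have [hd he h0] : [/\ h < d, h < e & 0 < h].
  by rewrite /h; case: (leP d e) => *; split; lra.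
have := quot_lt0 (- h); rewrite /= sub0r opprK gtr0_norm// oppr_eq0 gt_eqF//. 
move=> /(_ hd isT).
rewrite /GRing.scale /= mulr1 nmulr_rlt0 ?invr_lt0 ?oppr_lt0// subr_gt0.
rewrite ltNge => /negP; apply; rewrite addrC; apply: fle => /=.
  by rewrite opprB addrC subrK gtr0_norm.
by rewrite gtrBl.
Qed.

(** At the first time when some member of the family reaches 0, that member
    comes from below, so its derivative there is nonnegative. It is therefore
    enough to exclude such a derivative at the times when all members are
    nonpositive. The infimum [s] of the bad times is such a time: left
    continuity at [s] gives nonpositivity, right continuity and the finiteness
    of the family give a member that vanishes. Differentiability is asked only
    for positive times, hence the separate right continuity at 0. *)
Lemma first_crossing (R : realType) (I : finType) (T : R) (h dh : I -> R -> R) :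
  (forall k, h k 0 < 0) -> (forall k, h k t @[t --> 0^'+] --> h k 0) ->
  (forall k (t : R), 0 < t -> is_derive t 1 (h k) (dh k t)) ->
  (forall k (t : R), 0 < t -> t <= T -> (forall l, h l t <= 0) -> h k t = 0 ->
    dh k t < 0) ->
  forall k t, 0 <= t -> t <= T -> h k t < 0.
Proof.
move=> h0 hr hD hdh.
have hc k t : 0 < t -> {for t, continuous (h k)}.
  move=> t0; apply: differentiable_continuous; apply/derivable1_diffP.
  by have := hD k t t0.
move=> k t t0 tT; rewrite ltNge; apply/negP => hkt.
pose S := [set u : R | 0 <= u /\ exists l, 0 <= h l u].
have St : S t by split => //; exists k.
have lbS : has_lbound S by exists 0 => u [].
have infS : has_inf S by split=> //; exists t.
set s := inf S.
have s_ge0 : 0 <= s by apply: lb_le_inf; [exists t | move=> u []].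
have s_leT : s <= T by apply: le_trans tT; apply: ge_inf.
have before u l : 0 <= u -> u < s -> h l u < 0.
  move=> u0; apply: contraTT; rewrite -!leNgt => hlu.
  by apply: ge_inf => //; split=> //; exists l.
have s_right l : h l u @[u --> s^'+] --> h l s.
  have [s0|s0|<-] := ltgtP 0 s; last exact: hr.
    by apply: cvg_at_right_filter; exact: hc.
  by move: s_ge0; rewrite leNgt s0.
have hs_le0 l : h l s <= 0.
  rewrite leNgt; apply/negP => hls.
  have s0 : 0 < s.
    rewrite lt_neqAle s_ge0 andbT; apply/eqP => s0.
    by move: (h0 l); rewrite [X in h l X]s0 ltNge (ltW hls).
  have : \forall u \near s^'-, 0 < h l u.
    apply: (cvgr_gt (h l s)) => //.
    by apply: cvg_at_left_filter; exact: hc.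
  move=> hpos.
  near s^'- => u.
  have : 0 < h l u by near: u.
  have u0 : 0 < u by near: u; exact: nbhs_left_gt.
  have us : u < s by near: u; exact: nbhs_left_lt.
  by rewrite ltNge (ltW (before u l (ltW u0) us)).
have [l hls0] : exists l, h l s = 0.
  apply: contrapT => /forallNP hs_neq0.
  have : \forall u \near s^'+, forall l, h l u < 0.
    apply: filter_forall => l; apply: (cvgr_lt (h l s)) => //.
    by rewrite lt_neqAle hs_le0 andbT; apply/eqP/hs_neq0.
  case=> e /= e0 after.
  have [u [u0 [l hlu]]] := inf_adherent e0 infS.
  rewrite -/s => use.
  have : h l u < 0.
    have [us|su|->] := ltgtP u s; first exact: before.
      by apply: after => //=; rewrite ltr0_norm ?subr_lt0// opprB ltrBlDl.
    by rewrite lt_neqAle hs_le0 andbT; apply/eqP/hs_neq0.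
  by rewrite ltNge hlu.
have s_gt0 : 0 < s.
  rewrite lt_neqAle s_ge0 andbT; apply/eqP => s0.
  by move: (h0 l); rewrite [X in h l X]s0 hls0 ltxx.
have := hdh l s s_gt0 s_leT hs_le0 hls0; rewrite ltNge => /negP; apply.
apply: left_max_derive_ge0 (hD l s s_gt0) _.
near=> u; rewrite hls0.
have u0 : 0 < u by near: u; exact: nbhs_left_gt.
have us : u < s by near: u; exact: nbhs_left_lt.
exact: ltW (before u l (ltW u0) us).
Unshelve. all: by end_near. Qed.

(** * Vanishing dissipation *)

(** Barbalat's argument without integrals. [F] decreases to its infimum, so from
    some time on it drops by less than [h * (e / 2)] over any interval of
    length [h]; by the mean value theorem [g] is below [e / 2] at some point of
    that interval, and its Lipschitz constant allows it to vary by at most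
    [e / 2] there once [h] is small. *)
Lemma dissipation_cvg0 (R : realType) (F g : R -> R) (L m : R) :
  (forall t : R, 0 < t -> is_derive t 1 F (- g t)) ->
  (forall t, 0 < t -> 0 <= g t) -> (forall t, 0 < t -> m <= F t) ->
  0 <= L -> (forall s t, 0 < s -> 0 < t -> `|g s - g t| <= L * `|s - t|) ->
  g t @[t --> +oo] --> 0.
Proof.
move=> FD g0 Fm L0 gL.
have mvt (s t : R) : 0 < s -> s < t ->
    exists2 c, s < c < t & F s - F t = g c * (t - s).
  move=> s0 st.
  have pos u : s <= u -> 0 < u by exact: lt_le_trans.
  have [u|v|c cst FE] := @MVT R F (fun u => - g u) s t st.
  - by rewrite in_itv => /andP[/ltW/pos u0 _]; exact: FD.
  - apply: derivable_within_continuous => u; rewrite in_itv => /andP[/pos u0 _].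
    by have := FD u u0.
  by exists c; [rewrite in_itv in cst | rewrite -opprB FE mulNr opprK].
have Fnincr (s t : R) : 0 < s -> s <= t -> F t <= F s.
  move=> s0; rewrite le_eqVlt => /orP[/eqP->//|st].
  have [c /andP[sc ct] FE] := mvt s t s0 st.
  by rewrite -subr_ge0 FE mulr_ge0 ?g0 ?subr_ge0 ?(ltW st)// (lt_trans s0).
pose S := F @` [set t | 0 < t].
have infS : has_inf S.
  by split; [exists (F 1); exists 1 => /= | exists m => _ [t t0 <-]; exact: Fm].
apply/cvgrPdist_lt => e e0.
have L1 : 0 < L + 1 by rewrite ltr_wpDl.
pose h := e / (2 * (L + 1)).
have h0 : 0 < h by rewrite divr_gt0// mulr_gt0.
have Lh : L * h <= e / 2.
  have -> : L * h = e / 2 * (L / (L + 1)) by rewrite /h; field; rewrite gt_eqF.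
  by rewrite ler_piMr ?ler_pdivrMr ?divr_ge0 ?(ltW e0)// mul1r lerDl.
have he0 : 0 < h * (e / 2) by rewrite mulr_gt0// divr_gt0.
have [_ [t0 t0_gt0 <-] Ft0] := inf_adherent he0 infS.
near=> t.
have t0t : t0 <= t by near: t; apply: nbhs_pinfty_ge; exact: num_real.
have t_gt0 : 0 < t by exact: lt_le_trans t0t.
have [|c /andP[tc cth] FE] := mvt t (t + h) t_gt0 _; first by rewrite ltrDl.
have gc : g c < e / 2.
  rewrite -(ltr_pM2r h0).
  have -> : g c * h = F t - F (t + h) by rewrite FE [t + h]addrC addrK.
  rewrite ltrBlDr.
  apply: le_lt_trans (Fnincr _ _ t0_gt0 t0t) _; apply: lt_le_trans Ft0 _.
  rewrite [e / 2 * h]mulrC addrC lerD2l; apply: ge_inf; first by case: infS.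
  by exists (t + h) => //=; rewrite addr_gt0.
rewrite sub0r normrN ger0_norm ?g0//.
have := gL t c t_gt0 (lt_trans t_gt0 tc).
have : L * `|t - c| <= L * h.
  by rewrite ler_wpM2l// distrC gtr0_norm ?subr_gt0// lerBlDl ltW.
have := ler_norm (g t - g c).
lra.
Unshelve. all: by end_near. Qed.

(** * Spread of the phases and the matrix P *)

Lemma phase_spread_ge (R : realType) (n : nat) (x : 'I_n.+1 -> R) i j :
  x i - x j <= phase_spread x.
Proof. by rewrite lerB//; [exact: le_bigmax | exact: bigmin_le]. Qed.

Lemma phase_spread_le (R : realType) (n : nat) (x : 'I_n.+1 -> R) (D : R) :
  (forall i j, x i - x j <= D) -> phase_spread x <= D.
Proof.
move=> xD; rewrite /phase_spread lerBlDr; apply/bigmax_leP; split=> [|i _].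
all: rewrite -lerBlDl; apply/bigmin_geP; split=> [|j _].
all: by rewrite lerBlDl addrC -lerBlDl.
Qed.

Lemma PmxE (R : realType) (n : nat) (G : sgraph n) i j :
  Pmx R G i j = \sum_k (G i k)%:R * (G j k)%:R + 2 * (G i j)%:R.
Proof.
rewrite !mxE; congr (_ + _); apply: eq_bigr => k _; by rewrite !mxE.
Qed.

Lemma Pmx_ge0 (R : realType) (n : nat) (G : sgraph n) i j : 0 <= Pmx R G i j.
Proof.
by rewrite PmxE addr_ge0 ?mulr_ge0// sumr_ge0// => k _; rewrite mulr_ge0.
Qed.

(** The distance is an infimum of natural numbers, so if no path had length at
    most 2 it would be at least 3. *)
Lemma diameter_le2 (R : realType) (n : nat) (G : sgraph n) i j :
  (diameter R G <= 2%:E)%E -> i != j ->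
  G i j \/ exists k, G i k && G j k.
Proof.
move=> diam ij.
have dist2 : (gdist R G i j <= 2%:E)%E.
  by apply: le_trans diam; apply: ereal_sup_ubound; exists (i, j).
have [p [p_ij p2]] : exists p, is_gpath G i j p /\ (size p <= 2)%N.
  apply: contrapT => /forallNP no_path.
  suff : (3%:E <= gdist R G i j)%E.
    by move=> /le_trans /(_ dist2); rewrite lee_fin ler_nat.
  apply/ereal_infP => _ [p p_ij <-].
  rewrite lee_fin ler_nat ltnNge; apply/negP => p2.
  by apply: (no_path p).
move: p_ij p2 => /and3P[+ /eqP + _].
case: p => [|k [|l [|]]] //=.
- by move=> _ ij'; rewrite ij' eqxx in ij.
- by rewrite andbT => Gik <- _; left.
- by move=> /and3P[Gik Gkl _] <- _; right; exists k; rewrite Gik adj_sym.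
Qed.

Lemma Pmx_gt0 (R : realType) (n : nat) (G : sgraph n) i j :
  (diameter R G <= 2%:E)%E -> i != j -> 0 < Pmx R G i j.
Proof.
move=> diam ij; rewrite PmxE.
have [-> | [k /andP[Gik Gjk]]] := diameter_le2 diam ij.
  by rewrite ltr_wpDl ?mulr_gt0// sumr_ge0.
rewrite ltr_pwDl ?mulr_ge0// (bigD1 k)//= Gik Gjk mulr1.
by rewrite ltr_pwDl// sumr_ge0.
Qed.

(** * Invariance of the bound on the phase gaps *)

(** The comparison is made vertex by vertex: a common neighbor of [i] and [j]
    accounts for one [sin (x i - x j)] by subadditivity, every other vertex
    outside [i] and [j] contributes a nonpositive amount, and an edge between
    [i] and [j] is met twice, at [k = i] and at [k = j]; hence the coefficient
    [P i j]. *)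
Lemma field_extremal_gap_le (R : realType) (n : nat) (G : sgraph n)
    (w : 'I_n -> R) (K : R) (x : 'I_n -> R) (i j : 'I_n) :
  0 <= K -> i != j -> (forall k, x j <= x k <= x i) -> x i - x j <= pi ->
  kuramoto_field G w K x i - kuramoto_field G w K x j
    <= w i - w j - K / n%:R * (Pmx R G i j * sin (x i - x j)).
Proof.
move=> K0 ij xk xpi; set S := sin (x i - x j).
have Kn : 0 <= K / n%:R by rewrite divr_ge0.
have xji : x j <= x i by have /andP[] := xk i.
have S0 : 0 <= S by rewrite /S sin_ge0_pi// subr_ge0 xji.
rewrite /kuramoto_field opprD addrACA lerD2l -mulrBr -mulrN ler_wpM2l//.
rewrite [X in X - _]big_mkcond [X in _ - X]big_mkcond -sumrB /=.
(* One of the two units of weight of an edge is charged to [k = i], the other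
   to [k = j]. *)
have -> : - (Pmx R G i j * S) = \sum_k
    - (((G i k)%:R * (G j k)%:R + (G i j)%:R * (k == i)%:R
        + (G i j)%:R * (k == j)%:R) * S).
  rewrite sumrN -mulr_suml !big_split -!mulr_sumr /= PmxE.
  have sum1 l : \sum_k (k == l)%:R = 1 :> R.
    by rewrite (bigD1 l)//= eqxx big1 ?addr0// => k /negbTE ->.
  by rewrite !sum1; congr (- (_ * _)); ring.
apply: ler_sum => k _.
have [->|ki] := eqVneq k i.
  rewrite adj_irrefl (negbTE ij) (adj_sym _ j) -/S.
  by case: (G i j); rewrite /= !(mulr0n, mulr1n); lra.
have [->|kj] := eqVneq k j.
  rewrite adj_irrefl -(opprB (x i)) sinN -/S.
  by case: (G i j); rewrite /= !(mulr0n, mulr1n); lra.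
have /andP[jk ki'] := xk k.
have sik : 0 <= sin (x i - x k) by rewrite sin_ge0_pi//; apply/andP; lra.
have skj : 0 <= sin (x k - x j) by rewrite sin_ge0_pi//; apply/andP; lra.
have Ssub : S <= sin (x i - x k) + sin (x k - x j).
  have -> : S = sin ((x i - x k) + (x k - x j)) by rewrite addrA subrK.
  by apply: sinD_le; apply/andP; split; lra.
rewrite -(opprB (x i)) sinN.
by case: (G i k); case: (G j k); rewrite /= !(mulr0n, mulr1n); lra.
Qed.

(** The gap [S] between the extremal phases satisfies
    [S' <= K / n * P i j * (sin D - sin S) <= K / n * P i j * (S - D)] whenever
    [D <= S <= pi]. Bounding the excess [S - D] by a small exponential barrier
    and letting the barrier shrink is Gronwall's argument; using all pairwise
    gaps as the family in [first_crossing] replaces the spread, a maximum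
    that need not be differentiable, by differentiable functions. *)
Lemma gap_invariant (R : realType) (n : nat) (G : sgraph n)
    (w : 'I_n -> R) (K D : R) (phi : R -> 'I_n -> R) :
  0 <= K -> 0 < D -> D < pi ->
  (forall i j, i != j -> w i - w j <= K / n%:R * (Pmx R G i j * sin D)) ->
  kuramoto_trajectory G w K phi ->
  (forall i j, phi 0 i - phi 0 j <= D) ->
  forall t : R, 0 <= t -> forall i j, phi t i - phi t j <= D.
Proof.
move=> K0 D0 Dpi wK traj init t t0 i j.
apply/ler_addgt0Pr => e e0.
(* The barrier must stay below [pi], where [field_extremal_gap_le] applies. *)
pose d := Num.min e (pi - D).
have [d0 de dpi] : [/\ 0 < d, d <= e & D + d <= pi].
  by rewrite /d; case: (leP e (pi - D)) => *; split; lra.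
have Kn : 0 <= K / n%:R by rewrite divr_ge0.
(* Any rate above every [K / n * P k l] makes the barrier win strictly. *)
pose c := 1 + \sum_(p : 'I_n * 'I_n) K / n%:R * Pmx R G p.1 p.2.
have c_gt k l : K / n%:R * Pmx R G k l < c.
  rewrite /c (bigD1 (k, l))//= addrCA ltr_pwDr// ltr_pwDl// sumr_ge0// => p _.
  by rewrite mulr_ge0// Pmx_ge0.
have c0 : 0 < c by apply: le_lt_trans (c_gt i j); rewrite mulr_ge0// Pmx_ge0.
(* The exponential is normalized at the final time: the barrier is at most [d]
   on the whole interval and equals [d] at its end. *)
pose b (s : R) : R := d * expR (c * (s - t)).
have b0 (s : R) : 0 < b s by rewrite mulr_gt0// expR_gt0.
have bD (s : R) : is_derive s 1 b (c * b s).
  have lin : is_derive s 1 (c *: (id - cst t)) (c *: (1 - 0)).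
    exact: is_deriveZ (is_deriveB (is_derive_id s 1) (is_derive_cst t s 1)).
  have expD := @is_derive1_comp _ _ _ _ _ _ (is_derive_expR _) lin.
  apply: (is_derive_eq (is_deriveZ d expD)).
  by rewrite subr0 /b /GRing.scale /= mulr1 mulrA mulrC.
pose h (p : 'I_n * 'I_n) (s : R) : R := phi s p.1 - phi s p.2 - (D + b s).
pose dh (p : 'I_n * 'I_n) (s : R) : R :=
  kuramoto_field G w K (phi s) p.1 - kuramoto_field G w K (phi s) p.2 - c * b s.
suff : h (i, j) t < 0.
  by rewrite /h /b subrr mulr0 expR0 mulr1 /=; lra.
apply: (@first_crossing R _ t h dh) => //.
- by move=> p; rewrite /h; have := init p.1 p.2; have := b0 0; lra.
- move=> p; have [/continuous_within_itvcyP[_ c1] _] := traj p.1.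
  have [/continuous_within_itvcyP[_ c2] _] := traj p.2.
  apply: cvgB; first exact: cvgB.
  apply: cvgD; first exact: cvg_cst.
  apply: cvg_at_right_filter; apply: differentiable_continuous.
  by apply/derivable1_diffP; have := bD 0.
- move=> p s s0; have [_ /(_ s s0) d1] := traj p.1.
  have [_ /(_ s s0) d2] := traj p.2.
  have -> : dh p s = kuramoto_field G w K (phi s) p.1
                   - kuramoto_field G w K (phi s) p.2 - (0 + c * b s).
    by rewrite add0r.
  apply: (@is_deriveB _ _ _ ((phi^~ p.1) - (phi^~ p.2)) (cst D + b)).
- move=> [k l] s s0 st hle; rewrite /h /dh /= => hkl.
  have bs : b s <= d.
    rewrite /b ler_piMr// ?(ltW d0)// -expR0 ler_expR.
    by rewrite mulr_ge0_le0 ?(ltW c0)// subr_le0.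
  (* The gap of the pair reaching the barrier is positive and maximal among all
     pairs, so [k] and [l] are distinct and extremal. *)
  have klE : phi s k - phi s l = D + b s by lra.
  have kl : k != l by apply/eqP => kl; move: klE (b0 s); rewrite kl; lra.
  have between m : phi s l <= phi s m <= phi s k.
    have := hle (m, l); have := hle (k, m); rewrite /h /= => *.
    by apply/andP; split; lra.
  have gap : phi s k - phi s l <= pi by lra.
  have := field_extremal_gap_le G w K0 kl between gap; rewrite klE.
  have := wK k l kl.
  have sinb : sin D - sin (D + b s) <= b s.
    apply: le_trans (ler_norm _) _; apply: le_trans (sin_lipschitz _ _) _.
    by rewrite opprD addrA subrr sub0r normrN gtr0_norm.
  have : K / n%:R * Pmx R G k l * (sin D - sin (D + b s))
      <= K / n%:R * Pmx R G k l * b s.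
    by rewrite ler_wpM2l// mulr_ge0// Pmx_ge0.
  have : K / n%:R * Pmx R G k l * b s < c * b s by rewrite ltr_pM2r.
  rewrite mulrBr -!mulrA; lra.
Qed.

(** * Gradient structure and synchronization *)

(** Each edge occurs in the double sum in both orientations, hence the
    division by 2. *)
Definition kuramoto_potential (R : realType) (n : nat) (G : sgraph n)
    (w : 'I_n -> R) (K : R) (x : 'I_n -> R) : R :=
  - (\sum_i w i * x i)
  - K / n%:R / 2 * \sum_i \sum_(j | G i j) cos (x j - x i).

(** Exchanging the two ends of an edge preserves the set of edges and changes
    the sign of the sine, so the parts with [v j] and with [- v i] are equal. *)
Lemma sum_edges_sin_diff (R : realType) (n : nat) (G : sgraph n)
    (x v : 'I_n -> R) :
  \sum_i \sum_(j | G i j) sin (x j - x i) * (v j - v i)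
  = - 2 * \sum_i v i * \sum_(j | G i j) sin (x j - x i).
Proof.
pose s i j := sin (x j - x i).
have swap : \sum_i \sum_(j | G i j) s i j * v j
          = - \sum_i v i * \sum_(j | G i j) s i j.
  rewrite (exchange_big_dep xpredT)//= -sumrN; apply: eq_bigr => j _.
  rewrite -mulrN -sumrN mulr_sumr; apply: eq_big => [i|i _].
    exact: adj_sym.
  by rewrite /s -(opprB (x i)) sinN mulrC.
under eq_bigr do (under eq_bigr do rewrite mulrBr; rewrite sumrB).
rewrite sumrB swap.
under [X in _ - X]eq_bigr do rewrite -mulr_suml mulrC.
by rewrite mulNr mulr_natl mulr2n opprD.
Qed.

(** The gradient of the potential is minus the Kuramoto field. *)
Lemma potential_is_derive (R : realType) (n : nat) (G : sgraph n)
    (w : 'I_n -> R) (K : R) (phi : R -> 'I_n -> R) (v : 'I_n -> R) (t : R) :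
  (forall i, is_derive t 1 (phi^~ i) (v i)) ->
  is_derive t 1 (fun u => kuramoto_potential G w K (phi u))
    (- \sum_i v i * kuramoto_field G w K (phi t) i).
Proof.
move=> phiD.
have linD : is_derive t 1 (fun u => \sum_i w i * phi u i) (\sum_i w i * v i).
  by apply: is_derive_bigsum => i _; exact: is_deriveZ.
have cosD : is_derive t 1
    (fun u => \sum_i \sum_(j | G i j) cos (phi u j - phi u i))
    (\sum_i \sum_(j | G i j) - sin (phi t j - phi t i) * (v j - v i)).
  by apply: is_derive_bigsum => i _; apply: is_derive_bigsum => j _.
apply: (is_derive_eq
  (is_deriveB (is_deriveN linD) (is_deriveZ (K / n%:R / 2) cosD))).
under [X in _ *: X]eq_bigr do under eq_bigr do rewrite mulNr.
under [X in _ *: X]eq_bigr do rewrite sumrN.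
rewrite sumrN sum_edges_sin_diff.
have -> : \sum_i v i * kuramoto_field G w K (phi t) i = \sum_i w i * v i
    + K / n%:R * \sum_i v i * \sum_(j | G i j) sin (phi t j - phi t i).
  rewrite mulr_sumr -big_split; apply: eq_bigr => i _ /=.
  by rewrite mulrDr mulrCA mulrC.
by rewrite /GRing.scale /=; lra.
Qed.

(** As [\sum_i w i = 0], the linear part equals [- \sum_i w i * (x i - x ord0)],
    which is controlled by the phase differences. *)
Lemma potential_bounded_below (R : realType) (n : nat) (G : sgraph n)
    (w : 'I_n -> R) (K D : R) :
  0 <= K -> \sum_i w i = 0 ->
  exists m, forall x : 'I_n -> R, (forall i j, x i - x j <= D) ->
    m <= kuramoto_potential G w K x.
Proof.
move=> K0 w0.
exists (- (\sum_i `|w i| * D)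
        - K / n%:R / 2 * \sum_i \sum_(j | G i j) (1 : R)) => x xD.
apply: lerB; last first.
  rewrite ler_wpM2l ?divr_ge0//; apply: ler_sum => i _; apply: ler_sum => j _.
  exact: cos_le1.
rewrite lerN2; case: n => [|n] in G w w0 x xD *; first by rewrite !big_ord0.
have -> : \sum_i w i * x i = \sum_i w i * (x i - x ord0).
  under [RHS]eq_bigr do rewrite mulrBr.
  by rewrite sumrB -mulr_suml w0 mul0r subr0.
apply: ler_sum => i _; apply: le_trans (ler_norm _) _.
rewrite normrM ler_wpM2l// ler_norml xD andbT.
by rewrite lerNl opprB.
Qed.

Lemma field_bounded (R : realType) (n : nat) (G : sgraph n)
    (w : 'I_n -> R) (K : R) :
  exists2 B, 0 <= B & forall x i, `|kuramoto_field G w K x i| <= B.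
Proof.
pose b i := `|w i| + `|K / n%:R| * \sum_(j | G i j) (1 : R).
have b0 i : 0 <= b i by rewrite addr_ge0// mulr_ge0// sumr_ge0.
exists (\sum_i b i) => [|x i]; first by rewrite sumr_ge0.
apply: (@le_trans _ _ (b i)); last first.
  by rewrite (bigD1 i)//= lerDl sumr_ge0.
apply: le_trans (ler_normD _ _) _; rewrite lerD2l normrM ler_wpM2l//.
apply: le_trans (ler_norm_sum _ _ _) _; apply: ler_sum => j _; exact: sin_max.
Qed.

Lemma field_lipschitz (R : realType) (n : nat) (G : sgraph n)
    (w : 'I_n -> R) (K : R) :
  exists2 L, 0 <= L & forall (x y : 'I_n -> R) d,
    (forall i, `|x i - y i| <= d) ->
    forall i, `|kuramoto_field G w K x i - kuramoto_field G w K y i| <= L * d.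
Proof.
pose l i := `|K / n%:R| * \sum_(j | G i j) (2 : R).
have l0 i : 0 <= l i by rewrite mulr_ge0// sumr_ge0.
exists (\sum_i l i) => [|x y d xyd i]; first by rewrite sumr_ge0.
have d0 : 0 <= d by apply: le_trans (xyd i).
apply: (@le_trans _ _ (l i * d)); last first.
  by rewrite ler_wpM2r// (bigD1 i)//= lerDl sumr_ge0.
rewrite /kuramoto_field opprD addrACA subrr add0r -mulrBr normrM -sumrB.
rewrite /l -mulrA ler_wpM2l// mulr_suml.
apply: le_trans (ler_norm_sum _ _ _) _; apply: ler_sum => j _.
apply: le_trans (sin_lipschitz _ _) _.
have -> : x j - x i - (y j - y i) = x j - y j - (x i - y i) by ring.
apply: le_trans (ler_normB _ _) _.
by have := xyd i; have := xyd j; lra.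
Qed.

(** Along a trajectory the velocity is the field, which is bounded; hence the
    phases are Lipschitz in time, hence so are the field and the sum of its
    squares, which is the rate at which the potential decreases. *)
Lemma field_cvg0 (R : realType) (n : nat) (G : sgraph n)
    (w : 'I_n -> R) (K D : R) (phi : R -> 'I_n -> R) :
  0 <= K -> \sum_i w i = 0 -> kuramoto_trajectory G w K phi ->
  (forall t : R, 0 <= t -> forall i j, phi t i - phi t j <= D) ->
  forall i, kuramoto_field G w K (phi t) i @[t --> +oo] --> 0.
Proof.
move=> K0 w0 traj gapD.
pose v t i := kuramoto_field G w K (phi t) i.
have phiD i (t : R) : 0 < t -> is_derive t 1 (phi^~ i) (v t i).
  by have [_] := traj i; exact.
have [B B0 vB] := field_bounded G w K.
have [L L0 vL] := field_lipschitz G w K.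
have [m Vm] := potential_bounded_below G D K0 w0.
have phi_lip i s t : 0 < s -> 0 < t -> `|phi s i - phi t i| <= B * `|s - t|.
  move=> s0 t0.
  apply: (@lipschitz_of_derive_bound R `]0, +oo[ (phi^~ i) (v^~ i) B);
    rewrite ?in_itv ?andbT//.
  - by move=> u; rewrite in_itv andbT; exact: phiD.
  - by move=> u _; exact: vB.
have v_lip i s t : 0 < s -> 0 < t -> `|v s i - v t i| <= L * (B * `|s - t|).
  by move=> s0 t0; apply: vL => j; exact: phi_lip.
have speed_cvg0 : \sum_i v t i ^+ 2 @[t --> +oo] --> 0.
  apply: (@dissipation_cvg0 R (fun t => kuramoto_potential G w K (phi t)) _
            (\sum_(i < n) (2 * B) * (L * B)) m) => /=.
  - move=> t t0; under eq_bigr do rewrite expr2.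
    exact: potential_is_derive (fun i => phiD i t t0).
  - by move=> t _; apply: sumr_ge0 => i _; exact: sqr_ge0.
  - by move=> t t0; apply: Vm => i j; apply: gapD; exact: ltW.
  - by apply: sumr_ge0 => i _; rewrite !mulr_ge0.
  move=> s t s0 t0; rewrite -sumrB mulr_suml.
  apply: le_trans (ler_norm_sum _ _ _) _; apply: ler_sum => i _.
  rewrite subr_sqr normrM mulrC -!mulrA mulrA.
  apply: ler_pM => //; last exact: v_lip.
  by apply: le_trans (ler_normD _ _) _; rewrite mulr_natl mulr2n lerD ?vB.
move=> i; apply/cvgrPdist_lt => e e0.
have /cvgrPdist_lt/(_ (e ^+ 2) (exprn_gt0 _ e0)) := speed_cvg0.
apply: filterS => t; rewrite !sub0r !normrN => sum_lt.
rewrite -(@ltr_pXn2r _ 2)// ?nnegrE ?(ltW e0)// real_normK ?num_real//.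
apply: le_lt_trans sum_lt; apply: le_trans (ler_norm _).
by rewrite (bigD1 i)//= lerDl sumr_ge0// => j _; exact: sqr_ge0.
Qed.

Theorem theorem1 (R : realType) (n : nat) (G : sgraph n.+1)
    (wbar : 'I_n.+1 -> R) (K D : R) (phi : R -> 'I_n.+1 -> R)
    (hdiam : (diameter R G <= 2%:E)%E)
    (hwbar : \sum_i wbar i = 0)
    (hphi : kuramoto_trajectory G wbar K phi)
    (hD0 : 0 < phase_spread (phi 0))
    (hD0D : phase_spread (phi 0) <= D)
    (hDpi : D < pi)
    (hK : forall i j : 'I_n.+1,
       n.+1%:R * `|wbar i - wbar j| / (Pmx R G i j * sin D) <= K) :
  (forall t : R, 0 <= t -> phase_spread (phi t) <= D) /\ frequency_sync phi.
Proof.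
have D0 : 0 < D by exact: lt_le_trans hD0D.
have sinD0 : 0 < sin D by rewrite sin_gt0_pi// D0.
(* A diagonal instance of the lower bound on [K] reads [0 <= K]. *)
have K0 : 0 <= K.
  by have := hK ord0 ord0; rewrite subrr normr0 mulr0 mul0r.
have hK' i j : i != j ->
    wbar i - wbar j <= K / n.+1%:R * (Pmx R G i j * sin D).
  move=> ij; apply: le_trans (ler_norm _) _.
  have PS0 : 0 < Pmx R G i j * sin D by rewrite mulr_gt0// Pmx_gt0.
  have := hK i j; rewrite ler_pdivrMr// mulrAC ler_pdivlMr//.
  by rewrite mulrC.
have gapD := gap_invariant K0 D0 hDpi hK' hphi
  (fun i j => le_trans (phase_spread_ge _ i j) hD0D).
split=> [t t0|i]; first by apply: phase_spread_le; exact: gapD.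
apply: cvg_trans (field_cvg0 K0 hwbar hphi gapD i).
apply: near_eq_cvg; near=> t.
have t0 : 0 < t by near: t; apply: nbhs_pinfty_gt; exact: num_real.
have [_ /(_ t t0) phiD] := hphi i.
by rewrite derive1E derive_val.
Unshelve. all: by end_near. Qed.
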